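(* Let $G$ be a finite solvable group with Fitting height $h$. Then among any $h+1$ distinct non-linear irreducible complex characters of $G$, there are two, say $\chi$ and $\psi$, and an element $g\in G$ such that $\chi(g)=0=\psi(g)$.
   Context: For $G$ solvable, the Fitting series is $\mathbf{F}_0(G)=1$, $\mathbf{F}_1(G)=\mathbf{F}(G)$ (the Fitting subgroup), $\mathbf{F}_i(G)/\mathbf{F}_{i-1}(G)=\mathbf{F}(G/\mathbf{F}_{i-1}(G))$ for $i\ge2$; the Fitting height is the least $h$ with $\mathbf{F}_h(G)=G$. A character $\chi$ is non-linear if $\chi(1)>1$. *)

(* Defs.v *)
From HB Require Import structures.
From mathcomp Require Import all_boot all_order all_algebra all_fingroup all_solvable all_field all_character.
Set Implicit Arguments. Unset Strict Implicit. Unset Printing Implicit Defensive.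
Import Order.TTheory GRing.Theory Num.Theory.

Fixpoint Fitting_series (gT : finGroupType) (G : {set gT}) (n : nat) : {set gT} :=
  match n with
  | 0 => 1%g
  | n.+1 => (coset (Fitting_series G n) @*^-1 'F(G / Fitting_series G n))%g
  end.

Definition Fitting_height_is (gT : finGroupType) (G : {set gT}) (h : nat) : Prop :=
  Fitting_series G h = G /\ (forall k, (k < h)%N -> Fitting_series G k <> G).

(* Main.v *)
(* Write F_k for the Fitting series. A non-linear chi restricts reducibly to
   F_0 = 1 and irreducibly to F_h = G, so it has a level k in {1, ..., h}: the
   least k such that its restriction to F_k is irreducible. By pigeonhole two of
   the h + 1 characters share a level k. As F_k / F_(k-1) is nilpotent, each of
   them vanishes on F_k outside some proper subgroup of F_k, and a group is not
   the union of two proper subgroups. *)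
Require Import Defs.
From HB Require Import structures.
From mathcomp Require Import all_boot all_order all_algebra all_fingroup all_solvable all_field all_character.
Import Order.TTheory GRing.Theory Num.Theory.
Local Open Scope group_scope.
Local Open Scope ring_scope.

(** A nontrivial nilpotent group has a nontrivial centre; a central subgroup of prime order, which
    is normal, pulls back to [E]. *)
Lemma nilpotent_quotient_normal_prime_ext (gT : finGroupType) (G L : {group gT}) :
  L <| G -> L \proper G -> nilpotent (G / L) ->
  exists E : {group gT}, [/\ L <| E, E <| G & prime #|E : L|].
Proof.
move=> nsLG ltLG nilGL.
have ntZ : (1 < #|'Z(G / L)|)%N.
  rewrite cardG_gt1 center_nil_eq1 // -subG1 quotient_sub1 ?normal_norm //.
  exact: proper_subn.
have [x Zx ox] := Cauchy (pdiv_prime ntZ) (pdiv_dvd _).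
have nsX : <[x]>%g <| (G / L)%g by rewrite sub_center_normal // cycle_subG.
have [E defE sLE nsEG] := inv_quotientN nsLG nsX.
have nsLE : L <| E := normalS sLE (normal_sub nsEG) nsLG.
exists E; split=> //.
by rewrite -card_quotient ?normal_norm //= -defE -orderE ox pdiv_prime.
Qed.

(** Subgroups of nilpotent groups are subnormal, so the last proper term of a subnormal chain from
    [T / L] up to [G / L] pulls back to [M]. *)
Lemma nilpotent_quotient_proper_normal (gT : finGroupType) (G L T : {group gT}) :
  L <| G -> nilpotent (G / L) -> L \subset T -> T \proper G ->
  exists M : {group gT}, [/\ T \subset M, M <| G & M \proper G].
Proof.
move=> nsLG nilGL sLT ltTG; have sTG := proper_sub ltTG.
have nsLT : L <| T := normalS sLT sTG nsLG.
have snT := nilpotent_subnormal nilGL (quotientS L sTG).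
have [eqTG | [Mbar [snTM nsM ltM]]] := subnormalEr snT.
  by rewrite -(quotientGK nsLT) eqTG quotientGK // properxx in ltTG.
have [M defM sLM nsMG] := inv_quotientN nsLG nsM.
have nsLM : L <| M := normalS sLM (normal_sub nsMG) nsLG.
exists M; split=> //.
  by rewrite -(quotientSGK (normal_norm nsLT)) // -defM subnormal_sub.
rewrite properEneq normal_sub // andbT; apply: contraTneq ltM => eqMG.
by rewrite defM eqMG properxx.
Qed.

(* If L is maximal among the normal subgroups above K to which chi restricts
   reducibly, the restriction to L is multiplicity-free because it splits one
   step (of prime index) above L; hence the inertia group of a constituent is
   proper and, by Clifford, chi is induced from it. *)
Lemma irr_Res_reducible_vanish (gT : finGroupType) (G K : {group gT}) (i : Iirr G) :
    K <| G -> nilpotent (G / K) -> 'Res[K] 'chi_i \notin irr K ->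
  exists2 M : {group gT}, M \proper G & 'chi_i \in 'CF(G, M).
Proof.
move=> nsKG nilGK redK.
pose P (L : {group gT}) := (L <| G) && ('Res[L] 'chi_i \notin irr L).
have [|L /maxgroupP[/andP[nsLG redL] maxL] sKL] :=
  @maxgroup_exists _ P K; first exact/andP.
have nilGL : nilpotent (G / L).
  by rewrite -(isog_nil (third_isog sKL nsKG nsLG)) quotient_nil.
have ltLG : L \proper G.
  rewrite properEneq normal_sub // andbT; apply: contraNneq redL => /group_inj->.
  by rewrite cfRes_id mem_irr.
have [E [nsLE nsEG prE]] := nilpotent_quotient_normal_prime_ext _ _ _ nsLG ltLG nilGL.
have irrE : 'Res[E] 'chi_i \in irr E.
  apply: contraTT prE => redE.
  have /= -> := maxL E _ (normal_sub nsLE); last by rewrite /P nsEG.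
  by rewrite indexgg.
have{irrE} [s chiE] := irrP irrE.
have chiL : 'Res[L] 'chi_i = 'Res[L] 'chi_s.
  by rewrite -chiE cfResRes ?normal_sub.
have [irrL | [c injc chiLc]] := cfRes_prime_irr_cases s nsLE (erefl _) prE.
  by rewrite chiL irrL in redL.
have dotc j : '['Res[L] 'chi_i, 'chi_(c j)] = 1.
  rewrite chiL chiLc cfdot_suml (bigD1 j) //= cfnorm_irr big1 ?addr0 // => k nkj.
  by rewrite cfdot_irr (inj_eq injc) (negPf nkj).
pose j0 := Ordinal (prime_gt0 prE); pose j1 := Ordinal (prime_gt1 prE).
have cst0 : c j0 \in irr_constt ('Res[L] 'chi_i).
  by rewrite irr_consttE dotc oner_eq0.
(* If ['chi_(c j0)] were invariant in [G], Clifford would make it, with multiplicity 1, the whole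
   restriction to [L], leaving no room for the constituent [c j1]. *)
have ltTG : 'I_G['chi_(c j0)] \proper G.
  rewrite properEneq Inertia_sub andbT; apply/eqP => eqTG.
  have := dotc j1; rewrite (Clifford_Res_sum_cfclass nsLG cst0) dotc scale1r.
  rewrite cfclass_invariant; last by rewrite -{1}eqTG subsetIr.
  by rewrite big_seq1 cfdot_irr (inj_eq injc) => /esym/eqP; rewrite oner_eq0.
have sLT := sub_Inertia 'chi_(c j0) (normal_sub nsLG).
have [M [sTM nsMG ltMG]] :=
  nilpotent_quotient_proper_normal _ _ _ 'I_G['chi_(c j0)]%G nsLG nilGL sLT ltTG.
exists M => //.
have [IndP _ imInd _ _] := constt_Inertia_bijection (c j0) nsLG.
have: i \in irr_constt ('Ind[G] 'chi_(c j0)) by rewrite constt_Ind_Res.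
rewrite -imInd => /imsetP[t /IndP irrt ->].
(* Induction in stages passes through the normal subgroup [M], and a class function induced from a
   normal subgroup vanishes outside it. *)
by rewrite cfIirrE // -(cfIndInd _ (normal_sub nsMG) sTM) cfInd_normal.
Qed.

(** With [a] outside [A] and [b] outside [B], one of [a], [b], [a * b] avoids both. *)
Lemma proper_setU_not_cover (gT : finGroupType) (G A B : {group gT}) :
  A \proper G -> B \proper G -> exists2 x, x \in G & (x \notin A) && (x \notin B).
Proof.
move=> /properP[sAG [a Ga nAa]] /properP[sBG [b Gb nBb]].
have [Ba|nBa] := boolP (a \in B); last by exists a; rewrite ?nAa.
have [Ab|nAb] := boolP (b \in A); last by exists b; rewrite ?nAb.
by exists (a * b)%g; [rewrite groupM | rewrite groupMr // nAa groupMl].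
Qed.

Lemma Fitting_series_group_set (gT : finGroupType) (G : {group gT}) (n : nat) :
  group_set (Fitting_series G n).
Proof.
elim: n => [|n gF] /=; first exact: groupP.
exact: (groupP (coset (group gF) @*^-1 'F(G / group gF))).
Qed.

Canonical Fitting_series_group (gT : finGroupType) (G : {group gT}) (n : nat) :=
  group (Fitting_series_group_set _ G n).

Lemma Fitting_series_normal (gT : finGroupType) (G : {group gT}) (n : nat) :
  Fitting_series G n <| G.
Proof.
elim: n => [|n nsFG] /=; first exact: normal1.
have := Fitting_normal (G / Fitting_series G n).
by rewrite -cosetpre_normal (quotientGK nsFG).
Qed.

Lemma Fitting_series_normalS (gT : finGroupType) (G : {group gT}) (n : nat) :
  Fitting_series G n <| Fitting_series G n.+1.
Proof. exact: normal_cosetpre. Qed.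

Lemma Fitting_series_quotient_nil (gT : finGroupType) (G : {group gT}) (n : nat) :
  nilpotent (Fitting_series G n.+1 / Fitting_series G n).
Proof. by rewrite /= cosetpreK Fitting_nil. Qed.

Theorem theorem5 (gT : finGroupType) (G : {group gT}) (h : nat)
  (solG : solvable G) (hG : Fitting_height_is G h)
  (S : {set Iirr G})
  (cardS : #|S| = h.+1)
  (nonlinS : forall i, i \in S -> 1 < 'chi[G]_i 1%g) :
  exists i, exists j, exists g,
    [/\ i \in S, j \in S, i != j, g \in G &
        'chi[G]_i g = 0 /\ 'chi[G]_j g = 0].
Proof.
have [defG _] := hG.
pose F := Fitting_series_group _ G.
pose irrF i n := 'Res[F n] 'chi[G]_i \in irr (F n).
have irrFh i : irrF i (@ord_max h).
  have defF : F h = G by apply: group_inj.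
  by rewrite /irrF [X in F X]/= defF cfRes_id mem_irr.
pose lev i := [arg min_(k < @ord_max h | irrF i k) (k : nat)].
have lev_gt0 i : i \in S -> lev i != ord0.
  move=> /nonlinS chi1; apply: contraTneq chi1 => lev0.
  have: irrF i (lev i) by rewrite /lev; case: arg_minnP.
  rewrite lev0 => /irrP[t /(congr1 (fun phi : 'CF(_) => phi 1%g))].
  rewrite cfRes1 => ->.
  (* Irreducible characters of the trivial group [F 0] have degree 1. *)
  by have /char_abelianP/(_ t)/lin_char1-> := abelian1 gT; rewrite ltxx.
have [i [j [Si Sj ne_ij eq_ij]]] : exists i j,
    [/\ i \in S, j \in S, i != j & lev i = lev j].
  have : ~~ dinjectiveb lev (mem S).
    (* Levels lie in ['I_h.+1] and avoid [ord0], so only [h] values are available. *)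
    apply: contraTN (leqnn h) => /dinjectiveP/card_in_imset cardlev.
    rewrite -ltnNge -[h.+1]cardS -cardlev.
    have /subset_leq_card : lev @: S \subset [set~ ord0].
      by apply/subsetP=> _ /imsetP[i Si ->]; rewrite !inE lev_gt0.
    by rewrite cardsC1 card_ord.
  case/dinjectivePn=> i Si [j /andP[ne_ji Sj] eq_ij].
  by exists i, j; rewrite eq_sym.
have vanish a : a \in S -> exists2 M : {group gT}, M \proper F (lev a) &
    forall x, x \in F (lev a) -> x \notin M -> 'chi_a x = 0.
  move=> Sa; have := lev_gt0 a Sa; rewrite -val_eqE /= -lt0n.
  rewrite /lev; case: arg_minnP => // -[[|k] ltk] //= /irrP[t chi_t] mink _.
  (* The vanishing lemma is applied inside [F k.+1], to the irreducible restriction ['chi_t];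
     minimality of the level makes ['chi_t] reducible on [F k]. *)
  have /irr_Res_reducible_vanish[] : 'Res[F k] 'chi_t \notin irr (F k).
  - rewrite -chi_t cfResRes ?normal_sub ?Fitting_series_normal ?Fitting_series_normalS //.
    by apply/negP=> /(mink (Ordinal (ltnW ltk)))/=; rewrite ltnn.
  - exact: Fitting_series_normalS.
  - exact: Fitting_series_quotient_nil.
  move=> M ltM chiM; exists M => // x Fx nMx.
  have sFG : F k.+1 \subset G by rewrite normal_sub ?Fitting_series_normal.
  rewrite -(cfResE 'chi_a sFG Fx) chi_t.
  exact: cfun_on0 chiM nMx.
have [[A ltA chiA] [B ltB chiB]] := (vanish i Si, vanish j Sj).
rewrite -eq_ij in ltB chiB.
have [x Fx /andP[nAx nBx]] := proper_setU_not_cover _ _ _ _ ltA ltB.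
exists i, j, x; split=> //; last by rewrite chiA ?chiB.
exact: subsetP (normal_sub (Fitting_series_normal _ G (lev i))) x Fx.
Qed.
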